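(* (i) Each Banach Lie algebra $\mathcal{L}$ has a complete, lower finite-gap chain of closed Lie ideals between $P_{\mathfrak{J}}(\mathcal{L})$ and $\mathcal{L}$, and a complete, lower finite-gap chain of closed Lie subalgebras between $P_{\mathfrak{S}}(\mathcal{L})$ and $\mathcal{L}$. (ii) Each separable Banach Lie algebra $\mathcal{L}$ has a sequence $\{J_{n}\}_{n=1}^{\infty}$ of closed Lie ideals of finite codimension and a sequence $\{L_{n}\}_{n=1}^{\infty}$ of closed Lie subalgebras of finite codimension such that $$J_{n+1}\subseteq J_{n}\ \text{ and }\ \bigcap_{n=1}^{\infty}J_{n}=P_{\mathfrak{J}}(\mathcal{L});\qquad L_{n+1}\subseteq L_{n}\ \text{ and }\ \bigcap_{n=1}^{\infty}L_{n}=P_{\mathfrak{S}}(\mathcal{L}).$$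
   Context: A Banach Lie algebra is a complex Lie algebra $\mathcal{L}$ which is a Banach space in a norm such that, for some $t_{\mathcal{L}}>0$, $\|[a,b]\|\leq t_{\mathcal{L}}\|a\|\|b\|$ for all $a,b\in\mathcal{L}$. $P_{\mathfrak{J}}(\mathcal{L})$ is the intersection of all proper closed Lie ideals of finite codimension in $\mathcal{L}$, and $P_{\mathfrak{S}}(\mathcal{L})$ is the intersection of all proper closed Lie subalgebras of finite codimension in $\mathcal{L}$ (each equals $\mathcal{L}$ if the corresponding family is empty). Finite codimension includes codimension $0$ in (ii). For a non-empty family $G$ of closed subspaces of a Banach space, $\mathfrak{p}(G)=\bigcap_{Y\in G}Y$ and $\mathfrak{s}(G)$ is the closed linear span of $\bigcup_{Y\in G}Y$. $G$ is complete if $G=\{\mathfrak{p}(G'):\varnothing\neq G'\subseteq G\}\cup\{\mathfrak{s}(G)\}$ and $G=\{\mathfrak{s}(G'):\varnothing\neq G'\subseteq G\}\cup\{\mathfrak{p}(G)\}$. $G$ is a lower finite-gap family if for each $Z\in G$ with $Z\neq\mathfrak{p}(G)$ there is $Y\in G$ with $Y\subset Z$ and $0<\dim(Z/Y)<\infty$. A chain is a family $C$ totally ordered by inclusion; it is between $A$ and $B$ if $\mathfrak{p}(C)=A$ and $\mathfrak{s}(C)=B$. *)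

(* Defs.v *)
From HB Require Import structures.
From mathcomp Require Import all_boot all_order all_algebra.
From mathcomp Require Import complex.
From mathcomp Require Import all_classical all_reals all_analysis.

Set Implicit Arguments.
Unset Strict Implicit.
Unset Printing Implicit Defensive.

Import Order.TTheory GRing.Theory Num.Theory.
Import numFieldNormedType.Exports.

Local Open Scope classical_set_scope.
Local Open Scope ring_scope.
Local Open Scope complex_scope.

HB.mixin Record Lmodule_isLieAlgebra (K : comNzRingType) L
    of GRing.Lmodule K L := {
  lie : L -> L -> L ;
  lie_linearl : forall b, linear (fun a => lie a b) ;
  lie_linearr : forall a, linear (lie a) ;
  liexx : forall a, lie a a = 0 ;
  lie_jacobi : forall a b c,
    lie a (lie b c) + lie b (lie c a) + lie c (lie a b) = 0
}.

#[short(type="lieAlgType")]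
HB.structure Definition LieAlgebra (K : comNzRingType) :=
  { L of Lmodule_isLieAlgebra K L & GRing.Lmodule K L }.

(* The norm of a normed module over R[i] takes its values in R[i] (they are
   nonnegative, hence real), so the constant t is embedded by t%:C. *)
HB.mixin Record LieAlgebra_isBanachLie (R : realType) L
    of CompleteNormedModule R[i] L & LieAlgebra R[i] L := {
  lie_bounded : exists2 t : R, 0 < t &
    forall a b : L, `|lie a b| <= t%:C * `|a| * `|b|
}.

#[short(type="banachLieType")]
HB.structure Definition BanachLie (R : realType) :=
  { L of LieAlgebra_isBanachLie R L & CompleteNormedModule R[i] L
       & LieAlgebra R[i] L }.

Section Subspaces.
Context {K : nzRingType} {V : lmodType K}.
Implicit Types (X Y Z : set V) (n : nat).

Definition is_subspace Y := submod_closed [in Y].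

Definition linear_span X : set V := smallest is_subspace X.

(* For subspaces Y `<=` Z: the classes of e 0, ..., e (n - 1) form a basis of
   the quotient Z / Y, so that dim (Z / Y) = n. *)
Definition quotient_dim Y Z n : Prop :=
  exists e : 'I_n -> V,
    [/\ forall i, Z (e i),
        forall z, Z z -> exists c : 'I_n -> K, Y (z - \sum_i c i *: e i)
      & forall c : 'I_n -> K, Y (\sum_i c i *: e i) -> forall i, c i = 0].

Definition finite_codim Y : Prop := exists n, quotient_dim Y setT n.

End Subspaces.

Section Families.
Context {K : numFieldType} {V : normedModType K}.
Implicit Types (G : set (set V)) (Y Z A B : set V).

Definition closed_subspace Y : Prop := is_subspace Y /\ closed Y.

Definition family_inf G : set V := \bigcap_(Y in G) Y.

Definition family_sup G : set V := closure (linear_span (\bigcup_(Y in G) Y)).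

Definition complete_family G : Prop :=
  G = [set family_inf G' | G' in [set G' | G' !=set0 /\ G' `<=` G]]
        `|` [set family_sup G]
  /\
  G = [set family_sup G' | G' in [set G' | G' !=set0 /\ G' `<=` G]]
        `|` [set family_inf G].

Definition lower_finite_gap G : Prop :=
  forall Z, G Z -> Z <> family_inf G ->
    exists Y, [/\ G Y, Y `<` Z & exists2 n, (0 < n)%N & quotient_dim Y Z n].

Definition is_chain G : Prop :=
  [/\ G !=set0, G `<=` closed_subspace & total_on G subset].

Definition chain_between G A B : Prop :=
  [/\ is_chain G, family_inf G = A & family_sup G = B].

End Families.

Definition separable (T : topologicalType) : Prop :=
  exists2 D : set T, countable D & dense D.

Section LieIdeals.
Context {R : realType} {L : banachLieType R}.
Implicit Types J M : set L.

Definition closed_lie_ideal J : Prop :=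
  closed_subspace J /\ forall a b, J b -> J (lie a b).

Definition closed_lie_subalgebra M : Prop :=
  closed_subspace M /\ forall a b, M a -> M b -> M (lie a b).

End LieIdeals.

(* A \bigcap over an empty family is setT. *)
Definition P_ideal {R : realType} (L : banachLieType R) : set L :=
  \bigcap_(J in [set J : set L |
    [/\ closed_lie_ideal J, J <> setT & finite_codim J]]) J.

Definition P_subalgebra {R : realType} (L : banachLieType R) : set L :=
  \bigcap_(M in [set M : set L |
    [/\ closed_lie_subalgebra M, M <> setT & finite_codim M]]) M.

Arguments P_ideal {R} L _ : assert.
Arguments P_subalgebra {R} L _ : assert.

(* Main.v *)
(** Starting from the whole algebra, repeatedly replace X by X `&` J for some
    proper closed ideal (or subalgebra) J of finite codimension not containing
    X, and take intersections at limit stages.  The members obtained form a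
    tower that is well ordered by reverse inclusion: every nonempty subfamily
    has a largest element, so closed spans stay in the tower, and the process
    can only stop at the intersection of all the J.  A step loses a finite
    dimension because X / (X `&` J) embeds in L / J.

    In the separable case the open sets ~` J cover the complement of their
    intersection, so countably many of them do (Lindelof), and the finite
    intersections of the corresponding J are decreasing. *)

Require Import Defs.
From HB Require Import structures.
From mathcomp Require Import all_boot all_order all_algebra.
From mathcomp Require Import complex.
From mathcomp Require Import all_classical all_reals all_analysis.

Import Order.TTheory GRing.Theory Num.Theory.
Import numFieldNormedType.Exports.

Local Open Scope classical_set_scope.
Local Open Scope ring_scope.

(** * Transfinite iteration of a shrinking map on sets *)

Section Tower.
Context {T : Type} (f : set T -> set T).
Hypothesis f_sub : forall X, f X `<=` X.

(** Inductive closure takes the place of a recursion over ordinals: [tower_bigcap] yields the limit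
    stages and, for empty [F], the starting stage [setT]. *)
Inductive tower : set T -> Prop :=
| tower_step X : tower X -> tower (f X)
| tower_bigcap (F : set (set T)) :
    (forall Y, F Y -> tower Y) -> tower (\bigcap_(Y in F) Y).

Lemma tower_setT : tower setT.
Proof. by rewrite -(bigcap_set0 id); apply: tower_bigcap. Qed.

(** Zermelo's comparability argument: a double induction in which [step] handles successor stages
    and [cap] handles limits. *)
Lemma tower_sub_step X Y : tower X -> tower Y -> Y `<=` X \/ X `<=` f Y.
Proof.
have step A B : B `<=` A \/ A `<=` f B -> A `<=` B \/ B `<=` f A ->
    B `<=` f A \/ f A `<=` f B.
  case=> [BA [AB|]|AfB _]; last 2 first.
  - by left.
  - by right; exact: subset_trans (f_sub _) AfB.
  - by right; have -> : A = B by apply/seteqP.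
have cap (F : set (set T)) B : (forall A, F A -> B `<=` A \/ A `<=` f B) ->
    B `<=` \bigcap_(A in F) A \/ \bigcap_(A in F) A `<=` f B.
  move=> FB; have [[A FA AfB]|noA] := pselect (exists2 A, F A & A `<=` f B).
    by right=> x /(_ _ FA) /AfB.
  left; apply: sub_bigcap => A FA.
  by case: (FB _ FA) => // AfB; case: noA; exists A.
move=> tX; elim: tX Y => {X} [X _ IHX Y tY|F _ IHF Y tY]; last first.
  by apply: cap => A FA; exact: IHF.
(* The second premise of [step] compares the same two sets with their roles exchanged; it is proved
   by an inner induction on [Y]. *)
apply: (step); first exact: IHX.
elim: tY => {Y} [Y tY IHY|F tF IHF]; last by apply: cap => A FA; exact: IHF.
by apply: step => //; exact: IHX.
Qed.

Lemma tower_total : total_on tower subset.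
Proof.
move=> X Y tX tY; case: (tower_sub_step _ _ tX tY); first by right.
by move=> XfY; left; exact: subset_trans XfY (f_sub _).
Qed.

(** Let [M] be the least tower member above all of [F]. If [M] were not in [F], each member of [F]
    would already lie in [f M], so minimality would give [M = f M]. The descent stops at such an
    [M], which puts [M] below the members of [F] too. *)
Lemma tower_has_max (F : set (set T)) : F !=set0 -> F `<=` tower ->
  exists2 M, F M & forall Y, F Y -> Y `<=` M.
Proof.
move=> [Y0 FY0] tF.
pose M := \bigcap_(Z in [set Z | tower Z /\ forall Y, F Y -> Y `<=` Z]) Z.
have tM : tower M by apply: tower_bigcap => Z [].
have ubM Y : F Y -> Y `<=` M by move=> FY; apply: sub_bigcap => Z [_]; exact.
exists M => //; apply: contrapT => nFM.
have MfM : M `<=` f M.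
  apply: bigcap_inf; split; first exact: tower_step.
  move=> Y FY; case: (tower_sub_step _ _ (tF _ FY) tM) => // MY.
  by case: nFM; have -> : M = Y by apply/seteqP; split=> //; exact: ubM.
(* M is then a fixed point of f, hence the least element of the tower *)
have MY Y : tower Y -> M `<=` Y.
  elim=> {Y} [Y tY MY|G tG MG]; last exact: sub_bigcap.
  by case: (tower_sub_step _ _ tM tY) => // YM;
    have <- : M = Y by apply/seteqP.
have MY0 : M `<=` Y0 by apply: MY; exact: tF.
by apply: nFM; have -> : M = Y0 by apply/seteqP; split=> //; exact: ubM.
Qed.

End Tower.

(** * Finite codimension through kernels of linear maps *)

Section FiniteCodimension.
Context {K : fieldType} {V : lmodType K}.
Implicit Types (X Y : set V) (n : nat).

Lemma is_subspaceP Y :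
  is_subspace Y <-> Y 0 /\ forall a u v, Y u -> Y v -> Y (a *: u + v).
Proof.
split=> -[Y0 YD]; split.
- by rewrite inE in Y0.
- by move=> a u v Yu Yv; move: (YD a u v); rewrite !inE; apply.
- by rewrite inE.
- by move=> a u v; rewrite !inE; exact: YD.
Qed.

Lemma is_subspaceB Y u v : is_subspace Y -> Y u -> Y v -> Y (u - v).
Proof.
by move=> /is_subspaceP[_ YD] Yu Yv; rewrite addrC -scaleN1r; exact: YD.
Qed.

Lemma is_subspace_sum Y n (c : 'I_n -> K) (e : 'I_n -> V) :
  is_subspace Y -> (forall i, Y (e i)) -> Y (\sum_i c i *: e i).
Proof.
move=> /is_subspaceP[Y0 YD] Ye; elim/big_ind: _ => // [u v Yu Yv|i _].
  by rewrite -[u]scale1r; exact: YD.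
by rewrite -[_ *: _]addr0; exact: YD.
Qed.

Lemma is_subspace_bigcap (F : set (set V)) :
  (forall Y, F Y -> is_subspace Y) -> is_subspace (\bigcap_(Y in F) Y).
Proof.
move=> Fsub; apply/is_subspaceP; split.
  by move=> Y /Fsub/is_subspaceP[].
move=> a u v Fu Fv Y FY; have /is_subspaceP[_ YD] := Fsub _ FY.
by apply: YD; [exact: Fu|exact: Fv].
Qed.

Lemma finite_codimT : finite_codim [set: V].
Proof.
exists 0%N, (fun _ => 0); split=> // [z _|c _ []//].
by exists (fun _ => 0).
Qed.

(** Freeness modulo [Y] makes coordinates unique, so any choice of them is linear. Kernels are
    easier to restrict and to intersect than bases of quotients. *)
Lemma finite_codim_ker Y : is_subspace Y -> finite_codim Y ->
  exists n (phi : {linear V -> 'rV[K]_n}), forall z, Y z <-> phi z = 0.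
Proof.
move=> subY [n [e [_ spane freee]]].
have /choice[c cP] z : exists c : 'I_n -> K, Y (z - \sum_i c i *: e i).
  exact: spane.
have c_unique z c' : Y (z - \sum_i c' i *: e i) -> c z =1 c'.
  move=> Yc' i; apply/eqP; rewrite -subr_eq0; apply/eqP.
  apply: (freee (fun i => c z i - c' i)).
  have := is_subspaceB _ _ _ subY Yc' (cP z).
  rewrite opprB addrCA addrAC addrN add0r -sumrB.
  by congr Y; apply: eq_bigr => j _; rewrite scalerBl.
pose coord z : 'rV[K]_n := \row_i c z i.
have coord_linear : linear coord.
  move=> a u v; apply/rowP => i; rewrite !mxE.
  apply: (c_unique _ (fun i => a * c u i + c v i)).
  have /is_subspaceP[_ /(_ a _ _ (cP u) (cP v))] := subY.
  rewrite scalerBr addrACA -opprD scaler_sumr -big_split /=.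
  congr (Y (_ - _)); apply: eq_bigr => j _.
  by rewrite scalerDl scalerA.
pose phi : {linear V -> 'rV[K]_n} :=
  HB.pack coord (GRing.isLinear.Build K V _ _ coord coord_linear).
exists n, phi => z; split=> [Yz|/rowP phi0].
  apply/rowP => i; rewrite !mxE; apply: (c_unique _ (fun=> 0)).
  by rewrite big1 ?subr0// => j _; rewrite scale0r.
have := cP z; rewrite big1 ?subr0// => j _.
by have := phi0 j; rewrite !mxE => ->; rewrite scale0r.
Qed.

(** Take a largest family in [X] whose images under [phi] are independent. Its size is at most [n]
    by a rank bound, and maximality makes it span [X] modulo [Y]. *)
Lemma quotient_dim_ker n (phi : {linear V -> 'rV[K]_n}) X Y :
  is_subspace X -> (forall z, Y z <-> X z /\ phi z = 0) ->
  exists m, quotient_dim Y X m.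
Proof.
move=> subX Yphi.
pose indep m := exists e : 'I_m -> V, (forall i, X (e i)) /\
  forall c : 'I_m -> K, phi (\sum_i c i *: e i) = 0 -> forall i, c i = 0.
have indep_le m : `[< indep m >] -> (m <= n)%N.
  move=> /asboolP[e [_ freee]].
  have /eqP <- : row_free (\matrix_i phi (e i)); last exact: rank_leq_col.
  apply: inj_row_free => v; rewrite mulmx_sum_row => v0.
  apply/rowP => i; rewrite mxE; apply: (freee (fun i => v 0 i)).
  rewrite linear_sum -[RHS]v0; apply: eq_bigr => j _.
  by rewrite rowK linearZ.
have indep0 : exists m, `[< indep m >].
  by exists 0%N; apply/asboolP; exists (fun=> 0); split=> [[]//|c _ []//].
have [m /asboolP[e [Xe freee]] m_max] := ex_maxnP indep0 indep_le.
exists m, e; split=> // [z Xz|c /Yphi[_]]; last exact: freee.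
have [ker_c|no_c] :=
    pselect (exists c : 'I_m -> K, phi (z - \sum_i c i *: e i) = 0).
  have [c c0] := ker_c; exists c; apply/Yphi; split=> //.
  by apply: is_subspaceB => //; exact: is_subspace_sum.
(* otherwise z could be added to the maximal independent family e *)
suff /m_max : `[< indep m.+1 >] by rewrite ltnn.
apply/asboolP; exists (fun i => oapp e z (unlift ord0 i)); split=> [i|c].
  by case: (unlift _ _) => [j|] //=.
rewrite big_ord_recl unlift_none /=.
under eq_bigr do rewrite liftK /=.
have [c0|c0] := eqVneq (c ord0) 0.
  rewrite c0 scale0r add0r => /(freee (fun i => c (lift ord0 i))) cl i.
  by case: (unliftP ord0 i) => [j|] ->.
(* The coefficient of [z] is invertible, so solving the relation for [z] contradicts [no_c]. *)
move=> phi0; case: no_c; exists (fun i => - (c ord0)^-1 * c (lift ord0 i)).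
apply: (@scalerI _ _ (c ord0)); first by [].
rewrite scaler0 -phi0 -linearZ scalerBr scaler_sumr -sumrN; congr (phi (_ + _)).
apply: eq_bigr => j _.
by rewrite scalerA mulrA mulrN divff// mulN1r scaleNr opprK.
Qed.

Lemma quotient_dimI X Y : is_subspace X -> is_subspace Y -> finite_codim Y ->
  exists n, quotient_dim (X `&` Y) X n.
Proof.
move=> subX subY /(finite_codim_ker _ subY)[n [phi Yphi]].
apply: (quotient_dim_ker _ phi) => // z.
by split=> -[Xz /Yphi].
Qed.

(** Two kernels meet in the kernel of the paired map into rows of length [n + m]. *)
Lemma finite_codimI X Y : is_subspace X -> is_subspace Y ->
  finite_codim X -> finite_codim Y -> finite_codim (X `&` Y).
Proof.
move=> subX subY /(finite_codim_ker _ subX)[n [phi Xphi]].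
move=> /(finite_codim_ker _ subY)[m [psi Ypsi]].
pose pair z := row_mx (phi z) (psi z).
have pair_linear : linear pair.
  by move=> a u v; rewrite /pair !linearP scale_row_mx add_row_mx.
pose chi : {linear V -> 'rV[K]_(n + m)} :=
  HB.pack pair (GRing.isLinear.Build K V _ _ pair pair_linear).
apply: (quotient_dim_ker _ chi) => [|z]; first by apply/is_subspaceP.
split=> [[/Xphi phi0 /Ypsi psi0]|[_]].
  by split=> //; rewrite /chi /= /pair phi0 psi0 row_mx0.
rewrite /chi /= /pair -[RHS]row_mx0 => /eq_row_mx[phi0 psi0].
by split; [exact/Xphi|exact/Ypsi].
Qed.

Lemma quotient_dim_gt0 X Y n : is_subspace Y -> Y `<` X ->
  quotient_dim Y X n -> (0 < n)%N.
Proof.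
case: n => // subY [YX nXY] [e [_ spane _]]; case: nXY => x Xx.
by have [c] := spane _ Xx; rewrite big_ord0 subr0.
Qed.

End FiniteCodimension.

(** * Complete chains with finite gaps *)

Section Chains.
Context {K : numFieldType} {V : normedModType K}.
Implicit Types (F N Q : set (set V)) (X Y : set V).

Lemma family_sup_max F X : closed_subspace X -> F X ->
  (forall Y, F Y -> Y `<=` X) -> family_sup F = X.
Proof.
move=> [subX closedX] FX maxX; rewrite /family_sup.
have -> : \bigcup_(Y in F) Y = X.
  by apply/seteqP; split=> [x [Y /maxX]|x Xx]; [exact|exists X].
by rewrite /linear_span smallest_id// -(closure_id _).1.
Qed.

(** Each member is both the infimum and the supremum of its own singleton. Conversely, suprema stay
    in [F] because they are attained by a largest member. *)
Lemma complete_family_max F : F `<=` closed_subspace -> F !=set0 ->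
  (forall F', F' `<=` F -> F (family_inf F')) ->
  (forall F', F' !=set0 -> F' `<=` F ->
    exists2 X, F' X & forall Y, F' Y -> Y `<=` X) ->
  complete_family F.
Proof.
move=> Fsub F0 Finf Fmax.
have Fsup F' : F' !=set0 -> F' `<=` F -> F (family_sup F').
  move=> F'0 F'F; have [X F'X Xmax] := Fmax _ F'0 F'F.
  by rewrite (family_sup_max _ _ (Fsub _ (F'F _ F'X)))//; exact: F'F.
have sub1 X : F X -> [set X] !=set0 /\ [set X] `<=` F.
  by move=> FX; split=> [|_ ->//]; exists X.
split; apply/seteqP; split=> X.
- by move=> FX; left; exists [set X]; [exact: sub1|exact: bigcap_set1].
- by move=> [[F' [_ /Finf] FF' <-]//|->]; exact: Fsup.
- move=> FX; left; exists [set X]; [exact: sub1|].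
  by apply: family_sup_max => // [|_ ->//]; exact: Fsub.
- by move=> [[F' [F'0 F'F] <-]|->]; [exact: Fsup|exact: Finf].
Qed.

Lemma bigcap_closedI N X Y :
  (forall F, F `<=` N -> N (\bigcap_(Z in F) Z)) -> N X -> N Y -> N (X `&` Y).
Proof.
move=> Ncap NX NY; have := Ncap [set X; Y].
by rewrite bigcap_setU !bigcap_set1; apply => Z [] ->.
Qed.

(** Common form for ideals and subalgebras: [Q] is to be the closed ones, [N] the proper ones among
    them of finite codimension. *)
Lemma exists_lower_finite_gap_chain N Q :
  Q `<=` closed_subspace -> (forall F, F `<=` Q -> Q (\bigcap_(Y in F) Y)) ->
  N `<=` Q -> N `<=` finite_codim ->
  exists C, [/\ C `<=` Q, chain_between C (\bigcap_(Y in N) Y) setT,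
                complete_family C & lower_finite_gap C].
Proof.
move=> Qsub Qcap NQ Nfin; set P := \bigcap_(Y in N) Y.
(* The default [setT] leaves [X] fixed when no member of [N] cuts it, that is, when [X] lies in
   [P]. *)
pose f X := X `&` xget setT [set Y | N Y /\ ~ X `<=` Y].
have f_sub X : f X `<=` X by move=> x [].
have f_cases X : (exists Y, [/\ N Y, ~ X `<=` Y & f X = X `&` Y]) \/
    (X `<=` P /\ f X = X).
  have [exY|noY] := pselect (exists Y, N Y /\ ~ X `<=` Y); [left|right].
    have [NY nXY] := xgetPex setT exY.
    by exists (xget setT [set Y | N Y /\ ~ X `<=` Y]).
  split; last by rewrite /f xgetPN ?setIT// => Y ?; apply: noY; exists Y.
  by apply: sub_bigcap => Y NY; apply: contrapT => nXY; apply: noY; exists Y.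
have tQ : tower f `<=` Q.
  move=> X; elim=> {X} [X _ QX|F _]; last exact: Qcap.
  have [[Y [/NQ QY _ ->]]|[_ ->//]] := f_cases X.
  exact: bigcap_closedI.
have tP X : tower f X -> P `<=` X.
  elim=> {X} [X _ PX|F _]; last exact: sub_bigcap.
  have [[Y [NY _ ->]]|[_ ->//]] := f_cases X.
  by rewrite subsetI; split=> //; exact: bigcap_inf.
have tsub X : tower f X -> closed_subspace X by move=> /tQ/Qsub.
have t_setT : tower f setT by exact: tower_setT.
have t_inf : family_inf (tower f) = P.
  have t_inf : tower f (family_inf (tower f)) by exact: tower_bigcap.
  apply/seteqP; split; last exact: tP.
  (* The least member lies inside its own image under [f], so no [Y] in [N] can cut it properly. *)
  have [[Y [_ nsub fE]]|[//]] := f_cases (family_inf (tower f)).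
  case: nsub; apply: subset_trans (@subIsetr _ (family_inf (tower f)) _).
  by rewrite -fE; apply: bigcap_inf; exact: tower_step.
exists (tower f); split=> //.
- split=> //; last by apply: family_sup_max => //; exact: tsub.
  by split; [exists setT|exact: tsub|exact: tower_total].
- apply: complete_family_max => //; first by exists setT.
    by move=> F Ft; exact: tower_bigcap.
  exact: tower_has_max.
- rewrite /lower_finite_gap t_inf => X tX XP.
  have [[Y [NY nXY fE]]|[XsubP _]] := f_cases X; last first.
    by case: XP; apply/seteqP; split=> //; exact: tP.
  have [subX _] := tsub _ tX; have [subY _] := Qsub _ (NQ _ NY).
  have [n dimn] := quotient_dimI _ _ subX subY (Nfin _ NY).
  have ltX : X `&` Y `<` X.
    by split=> [|XXY]; [exact: subIsetl|apply: nXY => x /XXY[]].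
  exists (f X); rewrite fE; split=> //; first by rewrite -fE; exact: tower_step.
  exists n => //; apply: quotient_dim_gt0 ltX dimn.
  by rewrite -fE; have [] := tsub _ (tower_step f _ tX).
Qed.

End Chains.

(** * Countable subfamilies in separable spaces *)

Section Separable.
Context {R : realType} {V : normedModType R[i]}.
Implicit Types (N Q : set (set V)).

(** Ball radii live in [R[i]], where positivity forces a zero imaginary part; this reduces the claim
    to the Archimedean property of [R]. *)
Lemma natSinv_complex_lt (e : R[i]) :
  0 < e -> exists k : nat, (k.+1%:R^-1 : R)%:C%C < e.
Proof.
case: e => a b; rewrite ltcE /= => /andP[/eqP -> a0].
have [k _ /(_ k (leqnn k)) ka] := near_infty_natSinv_lt (PosNum a0).
by exists k; rewrite ltcR.
Qed.

Lemma countable_bigcap_closed N : separable V -> N `<=` closed ->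
  exists F : nat -> set V,
    (forall n, N (F n) \/ F n = setT) /\ \bigcap_n F n = \bigcap_(Y in N) Y.
Proof.
move=> [D Dcount Ddense] Nclosed.
pose r (k : nat) : R[i] := (k.+1%:R^-1 : R)%:C%C.
have r0 k : 0 < r k by rewrite /r ltcR.
have /countable_injP[g g_inj] : countable (D `*` [set: nat]).
  exact: countableX.
(* The number [n] codes a ball with centre in [D] and radius [r k]. One member of [N] missing that
   ball is selected, or [setT] if there is none. *)
pose bad n := [set Y | N Y /\ exists p : V * nat,
  [/\ D p.1, g p = n & ball p.1 (r p.2) `&` Y = set0]].
exists (fun n => xget setT (bad n)); split.
  by move=> n; case: xgetP => [Y _ [NY _]|]; [left|right].
apply/seteqP; split=> x; last first.
  by move=> Nx n _; case: xgetP => // Y _ [NY _]; exact: Nx.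
move=> Fx Y NY; apply: contrapT => nYx.
have /nbhs_ballP[e /= e0 eY] : nbhs x (~` Y).
  by apply: open_nbhs_nbhs; split=> //; apply: closed_openC; exact: Nclosed.
(* Half of [e], so that a ball of radius [r k] containing [x] stays inside the ball of radius [e]
   around [x], hence misses [Y]. *)
have [k ke] : exists k, r k < e / 2.
  by apply: natSinv_complex_lt; rewrite divr_gt0.
have [d [xd Dd]] : ball x (r k) `&` D !=set0.
  apply: Ddense; last exact: ball_open.
  by exists x; exact: ballxx.
have badY : bad (g (d, k)) Y.
  split=> //; exists (d, k); split=> //=; rewrite -subset0 => z [dz Yz].
  by apply: (eY z) => //; apply: (@ball_split _ _ d);
    exact: le_ball (ltW ke) _ _.
(* The selected set may differ from [Y], but it misses the same ball, which contains [x]. *)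
have [_ [[d' k'] [/= Dd' gE]]] := xgetPex setT (ex_intro _ Y badY).
have [-> ->] : (d', k') = (d, k) by apply: g_inj => //; rewrite inE.
move=> /seteqP[+ _] => /(_ x); apply; split; first exact: ball_sym.
exact: Fx.
Qed.

Lemma countable_descending_finite_codim N Q : separable V ->
  Q `<=` closed_subspace -> (forall F, F `<=` Q -> Q (\bigcap_(Y in F) Y)) ->
  N `<=` Q -> N `<=` finite_codim ->
  exists J : nat -> set V, [/\ forall n, Q (J n) /\ finite_codim (J n),
    forall n, J n.+1 `<=` J n & \bigcap_n J n = \bigcap_(Y in N) Y].
Proof.
move=> sepV Qsub Qcap NQ Nfin.
have [F [NF <-]] : exists F : nat -> set V,
    (forall n, N (F n) \/ F n = setT) /\ \bigcap_n F n = \bigcap_(Y in N) Y.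
  by apply: countable_bigcap_closed => // Y /NQ/Qsub[].
have QT : Q setT by rewrite -(bigcap_set0 id); exact: Qcap.
have QF n : Q (F n) /\ finite_codim (F n).
  have [NFn|->] := NF n; first by split; [exact: NQ|exact: Nfin].
  by split=> //; exact: finite_codimT.
(* Only indices below [n] enter: stage 0 is [setT], of codimension 0, and [F n] first enters at
   stage [n.+1]. *)
exists (fun n => \big[setI/setT]_(i < n) F i); split.
- elim=> [|n [QJ finJ]].
    by rewrite big_ord0; split=> //; exact: finite_codimT.
  have [QFn finF] := QF n; rewrite big_ord_recr /=.
  split; first exact: bigcap_closedI.
  by apply: finite_codimI => //; [have [] := Qsub _ QJ|have [] := Qsub _ QFn].
- by move=> n; rewrite big_ord_recr; exact: subIsetl.
apply/seteqP; split=> x Fx n _.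
  by have := Fx n.+1 I; rewrite big_ord_recr => -[].
by rewrite -bigcap_mkord => i _; exact: Fx.
Qed.

End Separable.

(** * Stability of closed ideals and subalgebras under intersection *)

Section LieFamilies.
Context {R : realType} (L : banachLieType R).
Implicit Types F : set (set L).

Lemma closed_subspace_bigcap F :
  F `<=` closed_subspace -> closed_subspace (\bigcap_(Y in F) Y).
Proof.
move=> Fsub; split; last by apply: closed_bigI => Y /Fsub[].
by apply: is_subspace_bigcap => Y /Fsub[].
Qed.

Lemma closed_lie_ideal_bigcap F :
  F `<=` closed_lie_ideal -> closed_lie_ideal (\bigcap_(Y in F) Y).
Proof.
move=> Fideal; split; first by apply: closed_subspace_bigcap => Y /Fideal[].
by move=> a b Fb Y FY; have [_] := Fideal _ FY; apply; exact: Fb.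
Qed.

Lemma closed_lie_subalgebra_bigcap F :
  F `<=` closed_lie_subalgebra -> closed_lie_subalgebra (\bigcap_(Y in F) Y).
Proof.
move=> Falg; split; first by apply: closed_subspace_bigcap => Y /Falg[].
move=> a b Fa Fb Y FY; have [_] := Falg _ FY.
by apply; [exact: Fa|exact: Fb].
Qed.

End LieFamilies.

Theorem proposition8p1 :
  (forall (R : realType) (L : banachLieType R),
     (exists C : set (set L),
        [/\ C `<=` closed_lie_ideal, chain_between C (P_ideal L) setT,
            complete_family C & lower_finite_gap C]) /\
     (exists C : set (set L),
        [/\ C `<=` closed_lie_subalgebra, chain_between C (P_subalgebra L) setT,
            complete_family C & lower_finite_gap C])) /\
  (forall (R : realType) (L : banachLieType R), separable L ->
     (exists J : nat -> set L,
        [/\ forall n, closed_lie_ideal (J n) /\ finite_codim (J n),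
            forall n, J n.+1 `<=` J n
          & \bigcap_n J n = P_ideal L]) /\
     (exists M : nat -> set L,
        [/\ forall n, closed_lie_subalgebra (M n) /\ finite_codim (M n),
            forall n, M n.+1 `<=` M n
          & \bigcap_n M n = P_subalgebra L])).
Proof.
split=> R L; [split|move=> sepL; split].
(* In all four cases [N] is the family whose intersection defines [P_ideal L] or
   [P_subalgebra L]. *)
- by apply: exists_lower_finite_gap_chain;
    [move=> X []|exact: closed_lie_ideal_bigcap|move=> X []..].
- by apply: exists_lower_finite_gap_chain;
    [move=> X []|exact: closed_lie_subalgebra_bigcap|move=> X []..].
- by apply: (countable_descending_finite_codim _ _ sepL);
    [move=> X []|exact: closed_lie_ideal_bigcap|move=> X []..].
- by apply: (countable_descending_finite_codim _ _ sepL);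
    [move=> X []|exact: closed_lie_subalgebra_bigcap|move=> X []..].
Qed.
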